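(* Let $m,p\ge 1$, $n=m+p$, let $D\subseteq\mathbb{R}^m\times\mathbb{R}^p$ be open, let $I$ be an open interval containing $0$, and let $\vec f:D\times I\to\mathbb{R}^m$ and $\vec g:D\times I\to\mathbb{R}^p$ be $C^\infty$. Fix $\varepsilon\in I$ with $\varepsilon>0$ and consider the system $$\vec x\,'=\vec f(\vec x,\vec z,\varepsilon),\qquad \vec z\,'=\varepsilon\,\vec g(\vec x,\vec z,\varepsilon),$$ with $\vec X=(\vec x,\vec z)\in D\subseteq\mathbb{R}^n$ and vector field $\vec V(\vec X)=\big(\vec f(\vec x,\vec z,\varepsilon),\varepsilon\,\vec g(\vec x,\vec z,\varepsilon)\big)$. Let $\phi:D\to\mathbb{R}$ be the associated flow curvature function $$\phi(\vec X)=\det\big(\dot{\vec X},\ddot{\vec X},\dots,\overset{(n)}{\vec X}\big),$$ and let $U\subseteq D$ be an open set, on which $\phi$ is $C^1$. If there exists a $C^1$ function $k:U\to\mathbb{R}$ (called a cofactor) such that $$L_{\vec V}\phi(\vec X)=k(\vec X)\,\phi(\vec X)\qquad\text{for all }\vec X\in U,$$ where $L_{\vec V}\phi=\vec V\cdot\vec\nabla\phi=\sum_{i=1}^n\frac{\partial\phi}{\partial X_i}V_i$, then the flow curvature manifold $\{\vec X\in U:\phi(\vec X)=0\}$ is invariant with respect to the flow of the system.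
   Context: Time derivatives along trajectories are regarded as functions of the state: $\dot{\vec X}=\vec V(\vec X)$, and recursively $\overset{(j+1)}{\vec X}=D\big(\overset{(j)}{\vec X}\big)(\vec X)\,\vec V(\vec X)$, i.e. $\overset{(j+1)}{\vec X}$ is the derivative of $\overset{(j)}{\vec X}$ along the vector field $\vec V$. The determinant is that of the $n\times n$ matrix whose columns are the first $n$ time derivatives of $\vec X$. The ''flow curvature manifold'' is the zero set of $\phi$ (it is called a manifold, but no regularity of the zero set is assumed). Invariance with respect to the flow (within $U$): for every solution $\vec X:J\to U$ of the system on an interval $J$, if $\phi(\vec X(t_0))=0$ for some $t_0\in J$, then $\phi(\vec X(t))=0$ for all $t\in J$. *)

(* Defs.v *)
From HB Require Import structures.
From mathcomp Require Import all_boot all_order all_algebra.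
From mathcomp Require Import all_classical all_reals all_analysis.

Set Implicit Arguments.
Unset Strict Implicit.
Unset Printing Implicit Defensive.
Import Order.TTheory GRing.Theory Num.Theory.
Import numFieldNormedType.Exports.

Local Open Scope classical_set_scope.
Local Open Scope ring_scope.

(* Functions are total on the ambient space; everything below only looks at
   their germs at points of an open set [A], so values off [A] are irrelevant.
   In finite dimension, asking every directional derivative [x |-> Df(x) v] to
   be C^k is the same as asking Df to be C^k. *)
Fixpoint Ck_on {R : realType} {E F : normedModType R} (k : nat)
    (A : set E) (h : E -> F) : Prop :=
  if k is k'.+1 then
    (forall x, A x -> differentiable h x) /\
    (forall v : E, Ck_on k' A ('D_v h))
  else forall x, A x -> {for x, continuous h}.

Definition smooth_on {R : realType} {E F : normedModType R}
    (A : set E) (h : E -> F) : Prop := forall k, Ck_on k A h.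

(* R^n is identified with R^m x R^p through X = col_mx x z. *)
Definition slow_fast_field {R : realType} {m p : nat}
    (f : 'cV[R]_m -> 'cV[R]_p -> R -> 'cV[R]_m)
    (g : 'cV[R]_m -> 'cV[R]_p -> R -> 'cV[R]_p)
    (eps : R) (X : 'cV[R]_(m + p)) : 'cV[R]_(m + p) :=
  let x := usubmx X in let z := dsubmx X in
  col_mx (f x z eps) (eps *: g x z eps).

(* [time_deriv V j] is the derivative of order [j.+1] of a trajectory, as a
   function of the state. *)
Fixpoint time_deriv {R : realType} {n : nat} (V : 'cV[R]_n -> 'cV[R]_n)
    (j : nat) : 'cV[R]_n -> 'cV[R]_n :=
  if j is j'.+1 then fun X => 'd (time_deriv V j') X (V X) else V.

Definition flow_curvature {R : realType} {n : nat} (V : 'cV[R]_n -> 'cV[R]_n)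
    (X : 'cV[R]_n) : R :=
  \det (\matrix_(i < n, j < n) time_deriv V j X i 0).

Definition lie_derivative {R : realType} {n : nat} (V : 'cV[R]_n -> 'cV[R]_n)
    (phi : 'cV[R]_n -> R) (X : 'cV[R]_n) : R :=
  \sum_(i < n) 'D_(delta_mx i 0) phi X * V X i 0.

(* The difference quotient is taken within [J], so that the derivative is
   one-sided at an endpoint belonging to [J]. *)
Definition is_solution_on {R : realType} {n : nat} (V : 'cV[R]_n -> 'cV[R]_n)
    (J : set R) (X : R -> 'cV[R]_n) : Prop :=
  forall t, J t ->
    (s - t)^-1 *: (X s - X t) @[s --> within J t^'] --> V (X t).

Definition flow_invariant_within {R : realType} {n : nat}
    (V : 'cV[R]_n -> 'cV[R]_n) (U S : set 'cV[R]_n) : Prop :=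
  forall (J : set R) (X : R -> 'cV[R]_n),
    is_interval J -> (forall t, J t -> U (X t)) -> is_solution_on V J X ->
    forall t0, J t0 -> S (X t0) -> forall t, J t -> S (X t).

(* Main.v *)
(** Along a solution X, the function y = phi o X satisfies the linear equation
    y' = (k o X) y.  On a segment where m <= k o X <= M, the function
    y^2 exp(-2 M t) is nonincreasing and y^2 exp(-2 m t) is nondecreasing;
    both are nonnegative, so a zero of y propagates forwards through the first
    and backwards through the second. *)
Require Import Defs.
From HB Require Import structures.
From mathcomp Require Import all_boot all_order all_algebra.
From mathcomp Require Import all_classical all_reals all_analysis.
From mathcomp Require Import ring.

Set Implicit Arguments.
Unset Strict Implicit.
Unset Printing Implicit Defensive.
Import Order.TTheory GRing.Theory Num.Theory.
Import numFieldNormedType.Exports.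

Local Open Scope classical_set_scope.
Local Open Scope ring_scope.

(** Write [X s] as [X t] plus [s - t] times the difference quotient: the quotient converges, so the
    added term tends to 0. *)
Lemma solution_within_continuous (R : realType) (n : nat)
    (V : 'cV[R]_n -> 'cV[R]_n) (J : set R) (X : R -> 'cV[R]_n) :
  is_solution_on V J X -> {within J, continuous X}.
Proof.
move=> sol; apply/subspace_continuousP => t Jt.
have cvgX : X t + (s - t) *: ((s - t)^-1 *: (X s - X t))
    @[s --> within J t^'] --> X t.
  rewrite -[X in _ --> X]addr0 -(scale0r (V (X t))) -(subrr t).
  apply: cvgD; first exact: cvg_cst.
  apply: cvgZ; last exact: sol.
  apply: cvgB; last exact: cvg_cst.
  by do 2 apply: cvg_within_filter; exact: cvg_id.
(* The limit [cvgX] is over [s != t]; the remaining case [s = t] holds because a neighbourhood of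
   [X t] contains [X t]. *)
move=> P XtP; have := cvgX P XtP; apply: (@filterS _ (nbhs t)) => s /= Ps Js.
have [->|st] := eqVneq s t; first exact: nbhs_singleton.
by have := Ps st Js; rewrite scalerA mulfV ?subr_eq0// scale1r subrKC.
Qed.

(** At an interior point of [J] the restriction to [J] is vacuous near [t], so the limit within [J]
    is a two-sided one; substitute [s = t + h]. *)
Lemma solution_is_derive (R : realType) (n : nat)
    (V : 'cV[R]_n -> 'cV[R]_n) (J : set R) (X : R -> 'cV[R]_n) (t : R) :
  is_solution_on V J X -> nbhs t J -> is_derive t 1 X (V (X t)).
Proof.
move=> sol tJ.
suff cvgX : h^-1 *: (X (h *: 1 + t) - X t) @[h --> 0^'] --> V (X t).
  by apply: DeriveDef; [apply/cvg_ex; exists (V (X t))|exact: cvg_lim].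
move=> P /(sol _ (nbhs_singleton tJ)) Ps.
have : \forall s \near t, s != t -> P ((s - t)^-1 *: (X s - X t)).
  by apply: (@filterS2 _ (nbhs t) _ _ _ _ _ Ps tJ) => s Ps' Js st; exact: Ps'.
move/nbhs0P; apply: filterS => h + h0.
by rewrite /= [h *: 1]mulr1 [t + h]addrC addrK; apply; rewrite -subr_eq0 addrK.
Qed.

Lemma lie_derivativeE (R : realType) (n : nat) (V : 'cV[R]_n -> 'cV[R]_n)
    (phi : 'cV[R]_n -> R) (X : 'cV[R]_n) :
  differentiable phi X -> lie_derivative V phi X = 'd phi X (V X).
Proof.
move=> dphi; rewrite [X in 'd phi _ X]matrix_sum_delta linear_sum.
by apply: eq_bigr => i _; rewrite big_ord1 linearZ deriveE//= mulrC.
Qed.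

(** Constant bounds on [k] stand in for its antiderivative in the integrating factor; each direction
    of time then uses its own bound. *)
Lemma linear_ode_eq0 (R : realType) (a b : R) (k y : R -> R) :
  a <= b ->
  {within `[a, b], continuous k} -> {within `[a, b], continuous y} ->
  (forall t, t \in `]a, b[ -> is_derive t 1 y (k t * y t)) ->
  y a = 0 <-> y b = 0.
Proof.
move=> ab ck cy dy.
(* Squaring makes [z c] nonnegative, so the sign of its derivative is governed by [2 * k t + c]. *)
pose z (c : R) t := y t ^+ 2 * expR (c * t).
have cz c : {within `[a, b], continuous (z c)}.
  move=> t; apply: cvgM; first exact: cvgM (cy t) (cy t).
  have cexp : continuous (fun s => expR (c * s)).
    move=> s; apply: continuous_comp; last exact: continuous_expR.
    exact: mulrl_continuous.
  exact: continuous_subspaceT cexp t.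
have dz c t : t \in `]a, b[ -> is_derive t 1 (z c) ((2 * k t + c) * z c t).
  move=> /dy dyt.
  have de : is_derive t 1 (fun s => expR (c * s)) (expR (c * t) * c).
    by apply/is_derive1_comp/is_derive_eq; rewrite [_ *: _]mulr1.
  apply: is_derive_eq.
  by rewrite /z -![_ *: _]/(_ * _); ring.
have z_eq0 c t : z c t = 0 -> y t = 0.
  by move=> /eqP; rewrite mulf_eq0 (gt_eqF (expR_gt0 _)) orbF sqrf_eq0 => /eqP.
have zE0 c t : y t = 0 -> z c t = 0 by rewrite /z => ->; rewrite expr0n mul0r.
have z_ge0 c t : 0 <= z c t by rewrite mulr_ge0 ?sqr_ge0 ?expR_ge0.
have [c _ kc] := EVT_max ab ck; have [d _ kd] := EVT_min ab ck.
split=> y0.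
(* Forwards: [k c] is the maximum of [k], so this [z] is nonincreasing and is squeezed between 0 and
   its value 0 at [a]. *)
- apply: (z_eq0 (- (2 * k c))); apply/eqP; rewrite eq_le z_ge0 andbT.
  rewrite -(zE0 (- (2 * k c)) _ y0).
  have z' t : t \in `]a, b[ -> is_derive t 1 (z (- (2 * k c))) _ := dz _ _.
  apply: (ler0_derive1_le_cc _ _ (cz _)); rewrite ?in_itv/= ?lexx ?ab// => t tab.
    by have [] := z' t tab.
  have [_ z't] := z' t tab.
  rewrite derive1E z't mulr_le0_ge0// -mulrBr pmulr_rle0// subr_le0 kc//.
  exact: subset_itv_oo_cc.
(* Backwards: with the minimum [k d], [z] is nondecreasing and its value at [a] is at most its value
   0 at [b]. *)
- apply: (z_eq0 (- (2 * k d))); apply/eqP; rewrite eq_le z_ge0 andbT.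
  rewrite -(zE0 (- (2 * k d)) _ y0).
  have z' t : t \in `]a, b[ -> is_derive t 1 (z (- (2 * k d))) _ := dz _ _.
  apply: (ger0_derive1_le_cc _ _ (cz _)); rewrite ?in_itv/= ?lexx ?ab// => t tab.
    by have [] := z' t tab.
  have [_ z't] := z' t tab.
  rewrite derive1E z't mulr_ge0// -mulrBr mulr_ge0// subr_ge0 kd//.
  exact: subset_itv_oo_cc.
Qed.

(** By the chain rule, the cofactor identity becomes a scalar linear equation for [phi \o X] on
    every segment of [J]. *)
Lemma invariant_of_cofactor (R : realType) (n : nat)
    (V : 'cV[R]_n -> 'cV[R]_n) (phi k : 'cV[R]_n -> R) (U : set 'cV[R]_n) :
  (forall X, U X -> differentiable phi X) ->
  (forall X, U X -> {for X, continuous k}) ->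
  (forall X, U X -> lie_derivative V phi X = k X * phi X) ->
  flow_invariant_within V U [set X | U X /\ phi X = 0].
Proof.
move=> dphi ck Lphi J X itvJ JU sol.
suff XP a b : a <= b -> J a -> J b -> phi (X a) = 0 <-> phi (X b) = 0.
  move=> t0 Jt0 [_ phi0] t Jt; split; first exact: JU.
  by have [/XP|/ltW/XP] := leP t0 t; move=> /(_ _ _); tauto.
move=> ab Ja Jb.
have abJ : `[a, b] `<=` J.
  by move=> t /=; rewrite in_itv/= => tab; exact: itvJ tab.
have cX := continuous_subspaceW abJ (solution_within_continuous sol).
apply: (@linear_ode_eq0 _ a b (k \o X) (phi \o X)) => //.
- apply: within_continuous_comp cX => _ /[!inE] -[t tab <-].
  exact/ck/JU/abJ.
- apply: within_continuous_comp cX => _ /[!inE] -[t tab <-].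
  exact/differentiable_continuous/dphi/JU/abJ.
- move=> t tab.
  (* Even if [a] or [b] is an endpoint of [J], a point strictly between them is interior to [J]. *)
  have tJ : nbhs t J.
    apply: filterS (near_in_itvoo tab) => s /subset_itv_oo_cc; exact: abJ.
  have UXt : U (X t) by exact: JU (nbhs_singleton tJ).
  have [dX X't] := solution_is_derive sol tJ.
  have diffX : differentiable X t by exact/derivable1_diffP.
  have diffphiX : differentiable (phi \o X) t.
    by apply: differentiable_comp => //; exact: dphi.
  apply: DeriveDef; first exact/derivable1_diffP.
  (* The derivative of [phi \o X] is ['d phi] applied to [V (X t)], that is, the Lie derivative at
     [X t]. *)
  rewrite deriveE// diff_comp//=; last exact: dphi.
  by rewrite -(deriveE _ diffX) X't -lie_derivativeE ?Lphi//; exact: dphi.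
Qed.

Theorem proposition2 (R : realType) (m p : nat) (m_gt0 : (0 < m)%N)
    (p_gt0 : (0 < p)%N)
    (D : set 'cV[R]_(m + p)) (I : set R)
    (f : 'cV[R]_m -> 'cV[R]_p -> R -> 'cV[R]_m)
    (g : 'cV[R]_m -> 'cV[R]_p -> R -> 'cV[R]_p)
    (eps : R) (U : set 'cV[R]_(m + p)) :
  let V := slow_fast_field f g eps in
  let phi := flow_curvature V in
  open D ->
  open I -> is_interval I -> I 0 ->
  smooth_on (D `*` I)
    (fun q : 'cV[R]_(m + p) * R => f (usubmx q.1) (dsubmx q.1) q.2) ->
  smooth_on (D `*` I)
    (fun q : 'cV[R]_(m + p) * R => g (usubmx q.1) (dsubmx q.1) q.2) ->
  I eps -> 0 < eps ->
  open U -> U `<=` D ->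
  Ck_on 1 U phi ->
  (exists k : 'cV[R]_(m + p) -> R,
    Ck_on 1 U k /\
    forall X, U X -> lie_derivative V phi X = k X * phi X) ->
  flow_invariant_within V U [set X | U X /\ phi X = 0].
Proof.
move=> V phi _ _ _ _ _ _ _ _ _ _ [dphi _] [k [[dk _] Lphi]].
apply: (invariant_of_cofactor dphi _ Lphi) => X UX.
exact/differentiable_continuous/dk.
Qed.
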